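(* (1) Every countably infinite discrete topological space $X$ has $c$ mutually non-homeomorphic metrizable compactifications of cardinality $c$; that is, there is a family of cardinality $c$ of metrizable compactifications of $X$, each of cardinality $c$, which are pairwise non-homeomorphic as topological spaces. (2) On every countably infinite set $X$ there exist $c$ incomplete metrics $d$ such that for each of them the topological space $(X,d)$ is discrete, the completion of the metric space $(X,d)$ is compact and of cardinality $c$, and the completions belonging to distinct ones of these metrics are not homeomorphic.
   Context: $c$ denotes the cardinality of $\mathbb{R}$. A compactification of a space $X$ is a compact Hausdorff space containing (a homeomorphic copy of) $X$ as a dense subspace. *)

(* Defs.v *)
From HB Require Import structures.
From mathcomp Require Import all_boot all_order all_algebra.
From mathcomp Require Import all_classical all_reals all_analysis.

Set Implicit Arguments.
Unset Strict Implicit.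
Unset Printing Implicit Defensive.

Local Open Scope classical_set_scope.
Local Open Scope ring_scope.

Definition homeomorphic (S T : topologicalType) : Prop :=
  exists (f : S -> T) (g : T -> S),
    [/\ cancel f g, cancel g f, continuous f & continuous g].

(* The coercion of [A : set K] to a type carries the subspace topology. *)
Definition is_compactification (X K : topologicalType) : Prop :=
  [/\ compact [set: K], hausdorff_space K &
      exists A : set K, dense A /\ homeomorphic X A].

(* Metrics on a bare type, so that one carrier may bear many of them; the
   fields are those of the factory [isMetric]. *)
Record metric_on (R : realType) (X : Type) := MetricOn {
  metric_fun :> X -> X -> R ;
  metric_xx : forall x, metric_fun x x = 0 ;
  metric_eq0 : forall x y, metric_fun x y = 0 -> x = y ;
  metric_fun_sym : forall x y, metric_fun x y = metric_fun y x ;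
  metric_fun_triangle : forall y x z,
    metric_fun x z <= metric_fun x y + metric_fun y z }.

Definition metric_space (R : realType) (X : Type) (d : metric_on R X) : Type := X.

HB.instance Definition _ (R : realType) (X : choiceType) (d : metric_on R X) :=
  Choice.copy (metric_space d) X.
HB.instance Definition _ (R : realType) (X : choiceType) (d : metric_on R X) :=
  isMetric.Build R (metric_space d) (@metric_xx R X d) (@metric_eq0 R X d)
    (@metric_fun_sym R X d) (@metric_fun_triangle R X d).

Definition metrizable (R : realType) (T : topologicalType) : Prop :=
  exists d : metric_on R T, @open T = @open (metric_space d).

(* The property carried by [discreteTopologicalType]. *)
Definition discrete_space (T : topologicalType) : Prop :=
  @nbhs T T = @principal_filter T.

(* The property carried by [completeType], which in addition has a
   distinguished point. *)
Definition complete_space (T : uniformType) : Prop :=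
  forall F : set_system T, ProperFilter F -> cauchy F -> exists x : T, F --> x.

(* Completions are determined only up to isometry. *)
Definition is_completion (R : realType) (M Y : metricType R) : Prop :=
  complete_space Y /\
  exists i : M -> Y,
    (forall x y, mdist (i x) (i y) = mdist x y) /\ dense (range i).

(* Main.v *)
(* For a set S of integers n >= 2 we build a closed set K_S of sequences over
   {0, 1, mark}, with the metric "inverse of the first index of disagreement".
   K_S consists of the Cantor set of unmarked sequences, of isolated points
   approximating each of them, and, near 1^n 0^oo for each n in S, of a copy of
   the ordinal omega^n + 1 with 1^n 0^oo as its top point. The isolated points
   are countable and dense, so K_S is a compactification of the discrete space
   they form.

   All points of K_S with a mark have finite Cantor-Bendixson rank, and n >= 2
   belongs to S iff some point x of infinite rank is a limit of points of rank
   exactly k for k < n and for no other k. So S is a topological invariant of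
   K_S, and coding a real by the rationals below it gives continuum many spaces.

   Pulling the metric back along a bijection between X and the isolated points
   gives the metrics of the second part: K_S is a completion, and completions
   are unique up to isometry, since a point of a completion is determined by its
   distances to X. None is complete: otherwise X itself would be a completion,
   but X is countable and K_S is not. *)
Require Import Defs.
From mathcomp Require Import all_boot all_order all_algebra.
From mathcomp Require Import all_classical all_reals all_analysis.
From mathcomp Require Import zify lra.

Set Implicit Arguments.
Unset Strict Implicit.
Unset Printing Implicit Defensive.
Import Order.TTheory GRing.Theory Num.Theory.
Import metricType_numDomainType.

Local Open Scope classical_set_scope.
Local Open Scope card_scope.

(** * Marked words *)

Notation word := (nat -> option bool).

Definition agree (N : nat) (x y : word) := forall i, (i < N)%N -> x i = y i.

Definition marks (z : word) (N : nat) : nat := \sum_(i < N) (z i == None).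

Definition starts (n : nat) (z : word) := forall i, z i = Some true <-> (i < n)%N.

(* [None] is a mark: a word is a 0-1 sequence that is read until its first mark
   and contains only 0s and marks afterwards. Two or more marks are allowed only
   on the words 1^n 0^oo with n in S, which may carry at most n of them. *)
Definition carrier (S : set nat) : set word := [set z |
  (forall i j, (i < j)%N -> z i = None -> z j <> Some true) /\
  ((forall N, (marks z N <= 1)%N) \/
   exists n, [/\ S n, starts n z & forall N, (marks z N <= n)%N])].

(* Rank is Cantor-Bendixson rank: n minus the number of marks for a marked word
   1^n 0^oo with n in S, infinite without marks, and 0 otherwise. *)
Definition rank_ge (S : set nat) (k : nat) (z : word) :=
  [\/ k = 0, forall i, z i <> None |
   exists n, [/\ S n, starts n z & forall N, (marks z N + k <= n)%N]].

(** An eventual value, since [marks] sees only finite prefixes. *)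
Definition total_marks (t : nat) (z : word) :=
  exists M, forall L, (M <= L)%N -> marks z L = t.

Lemma marksS z N : marks z N.+1 = (marks z N + (z N == None))%N.
Proof. by rewrite /marks big_ord_recr. Qed.

Lemma marks_mono z M N : (M <= N)%N -> (marks z M <= marks z N)%N.
Proof.
move=> /subnKC <-; elim: (N - M)%N => [|m ih]; first by rewrite addn0.
by rewrite addnS marksS (leq_trans ih)// leq_addr.
Qed.

Lemma marks_agree z z' N : agree N z z' -> marks z N = marks z' N.
Proof. by move=> h; apply: eq_bigr => i _; rewrite h. Qed.

Lemma marks_eq0 z : (forall i, z i <> None) -> forall N, marks z N = 0%N.
Proof.
by move=> h N; apply: big1 => i _; case: eqP => // /h.
Qed.

Lemma marks_gt0 z i N : z i = None -> (i < N)%N -> (0 < marks z N)%N.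
Proof.
move=> zi iN; apply: leq_trans (marks_mono z iN).
by rewrite marksS zi eqxx addn1.
Qed.

Lemma total_marks_le t z : total_marks t z -> forall N, (marks z N <= t)%N.
Proof.
move=> [M h] N; rewrite -(h (maxn M N)) ?leq_maxl//.
exact/marks_mono/leq_maxr.
Qed.

Lemma total_marksP z m : (forall N, (marks z N <= m)%N) ->
  exists2 t, (t <= m)%N & total_marks t z.
Proof.
elim: m => [|m ih] h.
  by exists 0%N => //; exists 0%N => L _; apply/eqP; rewrite -leqn0.
case: (pselect (forall N, (marks z N <= m)%N)) => [/ih[t tm ht]|].
  by exists t => //; lia.
move=> /existsNP[N /negP]; rewrite -ltnNge => mN.
exists m.+1 => //; exists N => L /(marks_mono z) NL; have := h L; lia.
Qed.

Lemma starts_inj m n z : starts m z -> starts n z -> m = n.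
Proof.
move=> hm hn; apply/eqP; rewrite eqn_leq; apply/andP; split; rewrite leqNgt.
- by apply/negP => /hm/hn; rewrite ltnn.
- by apply/negP => /hn/hm; rewrite ltnn.
Qed.

Lemma starts_no_true_after n z : starts n z ->
  forall i j, (i < j)%N -> z i = None -> z j <> Some true.
Proof.
move=> h i j ij zi /h jn; have /h := ltn_trans ij jn; by rewrite zi.
Qed.

Section Carrier.
Variable S : set nat.
Hypothesis S_gt1 : forall n, S n -> (1 < n)%N.

Lemma starts_carrier n z : S n -> starts n z ->
  (forall N, (marks z N <= n)%N) -> carrier S z.
Proof.
by move=> Sn zn h; split; [exact: starts_no_true_after zn|right; exists n].
Qed.

Lemma carrier_unmarked z : (forall i, z i <> None) -> carrier S z.
Proof.
move=> h; split; first by move=> i j _ /h.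
by left => N; rewrite marks_eq0.
Qed.

Lemma carrier_marks_le n z : carrier S z -> S n -> starts n z ->
  forall N, (marks z N <= n)%N.
Proof.
move=> [_ [h|[m [_ zm h]]]] Sn zn N; last by rewrite (starts_inj zn zm).
by rewrite (leq_trans (h N))// ltnW// S_gt1.
Qed.

Lemma carrier_total z : carrier S z -> exists t, total_marks t z.
Proof.
by move=> [_ [/total_marksP[t]|[n [_ _ /total_marksP[t]]]]] *; exists t.
Qed.

(* A mark within the common prefix forbids [true] beyond it, so the prefix
   decides where the [true]s are. *)
Lemma starts_agree z z' i N n :
  (forall i j, (i < j)%N -> z i = None -> z j <> Some true) ->
  (forall i j, (i < j)%N -> z' i = None -> z' j <> Some true) ->
  agree N z z' -> (i < N)%N -> z i = None -> starts n z -> starts n z'.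
Proof.
move=> h h' zz' iN zi zn j; have [jN|Nj] := ltnP j N; first by rewrite -zz'.
have ij := leq_trans iN Nj; split.
  by move/(h' i j ij); rewrite -zz'// => /(_ zi).
by move/zn => /h; move=> /(_ i ij zi).
Qed.

(** If a prefix of the limit [z] has two marks, every carrier word sharing it is some marked 1^n
    0^oo with n in S. A mark in the prefix fixes n, so one n serves all approximations and its bound
    on marks passes to the limit. *)
Lemma carrier_closed z :
  (forall N, exists2 z', carrier S z' & agree N z z') -> carrier S z.
Proof.
move=> h.
have h1 : forall i j, (i < j)%N -> z i = None -> z j <> Some true.
  move=> i j ij zi zj; have [z' [h' _] zz'] := h j.+1.
  by apply: (h' i j ij); rewrite -zz'// ltnS ltnW.
split=> //; case: (pselect (forall N, (marks z N <= 1)%N)); first by left.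
move=> /existsNP[N0 /negP]; rewrite -ltnNge => N01; right.
have [i iN zi] : exists2 i, (i < N0)%N & z i = None.
  case: (pselect (exists2 i, (i < N0)%N & z i = None)) => // /forall2NP hn.
  move: N01; rewrite /marks big1// => i _; case: eqP => // zi.
  by case: (hn i).
have key M : exists n, [/\ S n, starts n z & (marks z M <= n)%N].
  have [z' K' zz'] := h (maxn N0 M); have [h' [c|[n [Sn z'n c]]]] := K'.
    have := c N0; rewrite leqNgt -(marks_agree (z := z)) ?N01//.
    by move=> j jN; apply: zz'; rewrite leq_max jN.
  exists n; split => //.
    apply: (starts_agree h' h1 _ (i := i) (N := maxn N0 M)) => //.
    - by move=> j /zz'.
    - by rewrite leq_max iN.
    - by rewrite -zz'// leq_max iN.
  by rewrite (marks_agree (z' := z'))// => j jM; apply: zz'; rewrite leq_max jM orbT.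
have [n [Sn zn _]] := key 0%N; exists n; split=> // N.
by have [m [_ zm]] := key N; rewrite (starts_inj zn zm).
Qed.

(** * Adding marks and computing ranks *)

Definition put_mark M (z : word) : word := fun i => if i == M then None else z i.

Lemma marks_put M z L : z M <> None ->
  marks (put_mark M z) L = (marks z L + (M < L))%N.
Proof.
move=> zM; elim: L => [|L ih]; first by rewrite /marks !big_ord0.
rewrite !marksS ih /put_mark ltnS; case: (ltngtP L M) => [LM|ML|->].
- by rewrite !addn0.
- by rewrite addnAC.
- by move/eqP/negbTE: zM => ->; rewrite addn0.
Qed.

Lemma add_marks n z t u N : starts n z -> total_marks t z -> (t <= u)%N ->
  exists z', [/\ starts n z', total_marks u z' & agree N z z'].
Proof.
move=> zn ht /subnKC <-; elim: (u - t)%N => [|b [z' [z'n [M hM] zz']]].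
  by exists z; rewrite addn0; split.
(* From [M] on there are no marks, so this letter is free; from [N] on a change keeps the agreement;
   from [n] on it overwrites no leading 1. *)
set P := maxn M (maxn N n).
have z'P : z' P <> None.
  have := hM P.+1; rewrite marksS (hM P) ?leq_maxl//.
  move=> /(_ (leqW (leq_maxl _ _))) /eqP; rewrite -[X in _ == X]addn0 eqn_add2l.
  by rewrite eqb0 => /eqP.
exists (put_mark P z'); split.
- move=> i; rewrite /put_mark; case: eqP => // ->; split => //.
  by rewrite /P; lia.
- by exists P.+1 => L PL; rewrite marks_put// hM ?PL; lia.
- by move=> i iN; rewrite /put_mark ltn_eqF ?zz'// /P; lia.
Qed.

(** A positive [t] excludes the unmarked clause of [rank_ge], and [starts] determines [n]; what
    remains is rank [n - t], truncated at 0. *)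
Lemma rank_ge_starts n t k z : S n -> starts n z -> total_marks t z ->
  (0 < t)%N -> rank_ge S k z <-> k = 0%N \/ (t + k <= n)%N.
Proof.
move=> Sn zn ht t0; split=> [[->|h|[m [_ zm h]]]|[->|h]].
- by left.
- by case: ht => M /(_ M (leqnn _)); rewrite marks_eq0// => te; rewrite -te in t0.
- right; rewrite (starts_inj zn zm); case: ht => M /(_ M (leqnn _)) <-.
  exact: h.
- exact: Or31.
- apply: Or33; exists n; split=> // N.
  by rewrite (leq_trans _ h)// leq_add2r total_marks_le.
Qed.

(** A different carrier word sharing all [t] marks of [z] has a further mark, since only 0s and
    marks follow a mark. With two marks it is some 1^n 0^oo with n in S, and if its rank were at
    least [k], that of [z] would be at least [k.+1]. *)
Lemma rank_ge_shrink z k : carrier S z -> ~ rank_ge S k.+1 z ->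
  exists N, forall z', carrier S z' -> agree N z z' -> rank_ge S k z' -> z' = z.
Proof.
move=> Kz nz.
have /existsNP[i /contrapT zi] : ~ forall i, z i <> None.
  by move=> h; apply: nz; exact: Or32.
have [t ht] := carrier_total Kz; have [M hM] := ht.
set N := maxn M i.+1; exists N => z' Kz' zz' rz'.
have iN : (i < N)%N by rewrite /N; lia.
have MN : (M <= N)%N by rewrite /N; lia.
have z'i : z' i = None by rewrite -zz'.
have t0 : (0 < t)%N by rewrite -(hM N)//; exact: marks_gt0 zi iN.
have back n : starts n z' -> starts n z.
  apply: (starts_agree Kz'.1 Kz.1 _ iN z'i).
  by move=> j /zz'.
have z't : marks z' N = t by rewrite -(marks_agree zz') hM.
apply/funext => j; apply/eqP; apply/negP => /negP/eqP zj.
have Nj : (N <= j)%N by rewrite leqNgt; apply/negP => /zz'/esym.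
have z'j : z' j = None.
  case E : (z' j) => [[]|] //.
    by have := Kz'.1 i j (leq_trans iN Nj) z'i; rewrite E.
  case E' : (z j) => [[]|] //.
  - by have := Kz.1 i j (leq_trans iN Nj) zi; rewrite E'.
  - by rewrite E E' in zj.
  - have := hM j.+1; rewrite marksS E' hM; last by lia.
    by move=> /(_ (leq_trans MN (leqW Nj))); rewrite eqxx; lia.
have z'j1 : (t < marks z' j.+1)%N.
  by rewrite marksS z'j eqxx addn1 ltnS -z't marks_mono.
case: (Kz'.2) => [/(_ j.+1)|[n [Sn z'n hn]]]; first by lia.
apply: nz; apply/(rank_ge_starts _ Sn (back n z'n) ht t0); right.
case: rz' => [->|/(_ i)//|[m [_ z'm /(_ j.+1)]]]; first by have := hn j.+1; lia.
by rewrite -(starts_inj z'n z'm); lia.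
Qed.

(** Without marks, one letter can be flipped and the word stays unmarked; on 1^n 0^oo with n in S,
    one further mark far out uses up one unit of the available [n]. *)
Lemma rank_ge_approach z k N : rank_ge S k.+1 z ->
  exists z', [/\ carrier S z', z' <> z, agree N z z' & rank_ge S k z'].
Proof.
case=> // [h|[n [Sn zn h]]].
  pose z' : word := fun i => if i == N then Some (z N == Some false) else z i.
  have z'0 i : z' i <> None by rewrite /z'; case: ifP.
  exists z'; split; [exact: carrier_unmarked| | |exact: Or32]; last first.
    by move=> i iN; rewrite /z' ltn_eqF.
  by move=> /(congr1 (@^~ N)); rewrite /z' eqxx; case: (z N) => [[]|].
have [t tn ht] : exists2 t, (t + k.+1 <= n)%N & total_marks t z.
  have [|t tn ht] := @total_marksP z n; first by move=> L; have := h L; lia.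
  by exists t => //; case: (ht) => M /(_ M (leqnn M)) <-.
have [z' [z'n ht' zz']] := add_marks N zn ht (leqnSn t).
exists z'; split => //.
- apply: (starts_carrier Sn z'n) => L.
  by have := total_marks_le ht' L; lia.
- move=> zE; case: ht ht' => M hM []; rewrite zE => M' hM'.
  by have := hM (maxn M M') (leq_maxl _ _); rewrite hM' ?leq_maxr//; lia.
- by apply/(rank_ge_starts _ Sn z'n ht'); [lia|right; lia].
Qed.

Lemma rank_ge_dense z N : carrier S z ->
  exists z', [/\ carrier S z', agree N z z' & ~ rank_ge S 1 z'].
Proof.
move=> Kz; case: (pselect (rank_ge S 1 z)) => rz; last by exists z; split.
case: rz => // [h|[n [Sn zn _]]].
  (* A 0 at [N] followed by a 1 at [N.+1] rules out the form 1^n 0^oo, so a single mark at [N.+2]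
     gives rank 0. *)
  pose y : word := fun i => if (i < N)%N then z i else Some (i == N.+1).
  have y0 i : y i <> None by rewrite /y; case: ifP.
  exists (put_mark N.+2 y); split.
  - split.
      move=> i j ij; rewrite /put_mark; case: (eqVneq i N.+2) => [ei _|_ /y0//].
      rewrite /y gtn_eqF -?ei// ltnNge; case: leqP => [_|]; last by lia.
      by case; case: eqP => // ; lia.
    by left => L; rewrite marks_put// marks_eq0//; case: ltnP.
  - by move=> i iN; rewrite /put_mark /y iN; case: eqP => //; lia.
  - case=> // [/(_ N.+2)|[n [_ h' _]]]; first by rewrite /put_mark eqxx.
    have := (h' N.+1).1; rewrite /put_mark /y ltnNge leqnSn /= eqn_leq ltnn andbF eqxx.
    move=> /(_ erefl) Nn; have := (h' N).2 (ltnW Nn).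
    by rewrite /put_mark /y ltnn !ltn_eqF// !ltnS.
(* Filling up to the full number [n] of marks brings the rank down to 0. *)
have [t ht] := carrier_total Kz.
have tn : (t <= n)%N.
  case: (ht) => M /(_ M (leqnn M)) <-; exact: carrier_marks_le.
have [z' [z'n ht' zz']] := add_marks N zn ht tn.
exists z'; split=> //.
  by apply: (starts_carrier Sn z'n) => L; exact: total_marks_le.
by move/(rank_ge_starts _ Sn z'n ht') => -[]; [have := S_gt1 Sn; lia|by []|lia].
Qed.

(** * The points 1^n 0^oo and the recovery of S *)

Definition prefix_point n : word := fun i => Some (i < n)%N.

Lemma starts_prefix n : starts n (prefix_point n).
Proof. by move=> i; rewrite /prefix_point; case: (i < n)%N. Qed.

Lemma rank_near n k N : S n -> (k < n)%N ->
  exists z, [/\ carrier S z, agree N (prefix_point n) z,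
                rank_ge S k z & ~ rank_ge S k.+1 z].
Proof.
move=> Sn kn; have t0 : total_marks 0 (prefix_point n).
  by exists 0%N => L _; rewrite marks_eq0.
(* With [n - k] marks, 1^n 0^oo has rank exactly [k]. *)
have [z [zn ht pz]] := add_marks N (starts_prefix n) t0 (leq0n (n - k)).
have nk : (0 < n - k)%N by lia.
exists z; split=> //.
- by apply: (starts_carrier Sn zn) => L; have := total_marks_le ht L; lia.
- by apply/(rank_ge_starts _ Sn zn ht nk); right; lia.
- by move/(rank_ge_starts _ Sn zn ht nk) => -[]; lia.
Qed.

(** Words of finite positive rank are marked words 1^m 0^oo with m in S. They approach an unmarked
    [x] only if [x] is 1^m 0^oo, or is 1^oo with m unbounded. In the latter case every finite rank
    occurs near [x]; in the former exactly those below m, so m = n. *)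
Lemma rank_invariant n : (1 < n)%N -> S n <->
  exists x, [/\ carrier S x, forall k, rank_ge S k x &
    forall k, (forall N, exists z, [/\ carrier S z, agree N x z,
       rank_ge S k z & ~ rank_ge S k.+1 z]) <-> (k < n)%N].
Proof.
move=> n1; split=> [Sn|[x [Kx rx hx]]].
  exists (prefix_point n); split=> [|k|k].
  - exact: carrier_unmarked.
  - exact: Or32.
  (* Agreement on [n.+1] letters covers the first 0 of [prefix_point n] and forces [m = n]. *)
  split=> [/(_ n.+1)[z [Kz pz rz nrz]]|kn N]; last exact: rank_near.
  rewrite ltnNge; apply/negP => nk; case: rz => [k0|h|[m [Sm zm h]]].
  - by lia.
  - by apply: nrz; exact: Or32.
  have mn : m = n.
    apply/eqP; rewrite eqn_leq; apply/andP; split; rewrite leqNgt; apply/negP => lt.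
      by have /zm := lt; rewrite -pz// /prefix_point ltnn.
    have : z m = Some true by rewrite -pz /prefix_point ?lt//; lia.
    by move/zm; rewrite ltnn.
  apply: nrz; apply: Or32 => i zi; have := h i.+1.
  by have := marks_gt0 zi (ltnSn i); lia.
have x0 i : x i <> None.
  move=> xi; case: (rx 1%N) => // [/(_ i)//|[m [Sm xm h]]].
  case: (rx m) => [m0|/(_ i)//|[m' [_ xm' h']]]; first by have := S_gt1 Sm; lia.
  by have := h' i.+1; rewrite (starts_inj xm' xm); have := marks_gt0 xi (ltnSn i); lia.
(* Rank exactly 1 occurs near [x] because [1 < n]. *)
have key N : exists z m, [/\ S m, starts m z & agree N x z].
  have [z [_ xz rz nrz]] := (hx 1%N).2 n1 N.
  case: rz => // [h|[m [Sm zm _]]]; first by case: nrz; exact: Or32.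
  by exists z, m.
case: (pselect (exists j, x j <> Some true)) => [ex|/forallNP x1]; last first.
  have xT i : x i = Some true by exact: contrapT.
  suff /(hx n) : forall N, exists z, [/\ carrier S z, agree N x z,
     rank_ge S n z & ~ rank_ge S n.+1 z] by rewrite ltnn.
  (* Agreeing with 1^oo on [n.+1] letters forces [n < m], so rank [n] occurs near [prefix_point m],
     hence near [x]. *)
  move=> N; have [y [m [Sm ym xy]]] := key (maxn N n.+1).
  have mN : (maxn N n.+1 <= m)%N.
    rewrite leqNgt; apply/negP => lt.
    by have := xy _ lt; rewrite xT => /esym/ym; rewrite ltnn.
  have nm : (n < m)%N by lia.
  have [z [Kz pz r nr]] := rank_near N Sm nm; exists z; split=> // i iN.
  by rewrite -pz// xT /prefix_point; congr Some; lia.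
have exb : exists j, x j != Some true by case: ex => j /eqP; exists j.
case: (ex_minnP exb) => j /eqP xj jmin.
have xlt i : (i < j)%N -> x i = Some true.
  by move=> ij; apply/eqP; apply: contraTT ij => /jmin; lia.
have eqj N z m : (j < N)%N -> starts m z -> agree N x z -> m = j.
  move=> jN zm xz; apply/eqP; rewrite eqn_leq.
  apply/andP; split; rewrite leqNgt; apply/negP => lt.
    by apply: xj; rewrite xz//; apply/zm.
  by have := zm m; rewrite ltnn -xz ?xlt//; [case=> /(_ erefl)|lia].
have Sj : S j.
  by have [z [m [Sm zm /(eqj j.+1 _ _ (ltnSn j) zm) mj]]] := key j.+1; rewrite -mj.
have xj' : x = prefix_point j.
  apply/funext => i; have [z [m [Sm zm xz]]] := key (maxn i.+1 j.+1).
  have mj := eqj _ _ _ (leq_maxr _ _) zm xz; rewrite mj in zm.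
  rewrite /prefix_point; case: (ltnP i j) => [/xlt//|ji].
  have := zm i; have := x0 i; rewrite -xz ?leq_maxl//; case: (x i) => [[]|] // _.
  by case=> /(_ erefl); lia.
have eqv k : (k < j)%N <-> (k < n)%N.
  rewrite -hx xj'; split=> [kj N|/(_ j.+1)[z [Kz pz rz nrz]]]; first exact: rank_near.
  case: rz => [->|h|[m [Sm zm h]]].
  - by have := S_gt1 Sj; lia.
  - by case: nrz; exact: Or32.
  rewrite -xj' in pz; rewrite -(eqj _ _ _ (ltnSn j) zm pz) ltnNge; apply/negP => mk.
  by apply: nrz; apply: Or32 => i zi; have := h i.+1; have := marks_gt0 zi (ltnSn i); lia.
suff -> : n = j by [].
have := eqv j; have := eqv n; rewrite !ltnn; case: (ltngtP n j) => //.
- by move=> ? [/(_ isT)].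
- by move=> ? _ [_ /(_ isT)].
Qed.

(** A word of rank 0 has a mark and is 0 from some index on, so a finite list with default 0 encodes
    it. Conversely, the zero word with one mark at any place has rank 0, as it does not begin with
    1. *)
Lemma rank_eq0_card : [set z | carrier S z /\ ~ rank_ge S 1 z] #= [set: nat].
Proof.
set I := [set z | _]; rewrite card_eq_le; apply/andP; split.
  have : I `<=` range (fun s : seq (option bool) => (nth (Some false) s : word)).
    move=> z [Kz nz]; have [t [M hM]] := carrier_total Kz.
    have /existsNP[i /contrapT zi] : ~ forall i, z i <> None.
      by move=> h; apply: nz; exact: Or32.
    exists (mkseq z (maxn M i.+1)) => //; apply/funext => j.
    have [jM|Mj] := ltnP j (maxn M i.+1); first by rewrite nth_mkseq.
    rewrite nth_default ?size_mkseq//; case E : (z j) => [[]|] //.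
      by have := Kz.1 i j; rewrite zi E => h; exfalso; apply: h => //; lia.
    have := hM j.+1; rewrite marksS E eqxx hM; [lia|].
    by have := leq_maxl M i.+1; lia.
  move=> /subset_card_le h; apply: (card_le_trans h).
  exact: card_le_trans (card_image_le _ _) (countableP _).
pose f M := put_mark M (fun=> Some false).
have finj : {in setT &, injective f}.
  move=> M M' _ _ /(congr1 (@^~ M)); rewrite /f /put_mark eqxx.
  by case: eqP.
apply: card_le_trans (_ : range f #<= I).
  by rewrite (card_le_eqr (inj_card_eq finj)).
apply: subset_card_le => _ [M _ <-]; split.
  split=> [i j ij _|]; first by rewrite /f /put_mark; case: eqP.
  by left => L; rewrite marks_put// marks_eq0//; case: ltnP.
case=> // [/(_ M)|[n [/S_gt1 n1 /(_ 0%N)[_ h] _]]].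
  by rewrite /f /put_mark eqxx.
by have := h (ltnW n1); rewrite /f /put_mark; case: ifP.
Qed.

End Carrier.

Local Open Scope ring_scope.

(** * Homeomorphisms, completions and derived sets *)

Lemma homeomorphic_sym (S T : topologicalType) :
  homeomorphic S T -> homeomorphic T S.
Proof. by move=> [f [g [? ? ? ?]]]; exists g, f. Qed.

Lemma homeomorphic_trans (S T U : topologicalType) :
  homeomorphic S T -> homeomorphic T U -> homeomorphic S U.
Proof.
move=> [f [g [fK gK fc gc]]] [f' [g' [fK' gK' fc' gc']]].
exists (f' \o f), (g \o g'); split; [exact: can_comp|exact: can_comp| |].
- by move=> x; apply: continuous_comp; [exact: fc|exact: fc'].
- by move=> x; apply: continuous_comp; [exact: gc'|exact: gc].
Qed.

Lemma homeomorphic_compact (S T : topologicalType) :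
  homeomorphic S T -> compact [set: S] -> compact [set: T].
Proof.
move=> [f [g [_ gK fc _]]] cS.
have <- : f @` [set: S] = [set: T].
  by apply/seteqP; split => // x _; exists (g x).
apply: continuous_compact => //.
by apply: continuous_subspaceT; exact: fc.
Qed.

Lemma card_le_inj (T U : Type) (f : T -> U) :
  injective f -> [set: T] #<= [set: U].
Proof.
move=> fi; have fi' : {in [set: T] &, injective f} by move=> x y _ _ /fi.
by rewrite -(card_le_eql (inj_card_eq fi')); exact: subset_card_le.
Qed.

Lemma homeomorphic_card (S T : topologicalType) :
  homeomorphic S T -> [set: S] #= [set: T].
Proof.
move=> [f [g [fK gK _ _]]]; rewrite card_eq_le.
by rewrite (card_le_inj (can_inj fK)) (card_le_inj (can_inj gK)).
Qed.

(** * Uniqueness of completions *)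

Section Completion.
Variable R : realType.

Lemma isometry_continuous (Y Z : metricType R) (f : Y -> Z) :
  (forall x y, mdist (f x) (f y) = mdist x y) -> continuous f.
Proof.
move=> fd x; apply/cvgrPdist_lt => e e0; near=> y.
rewrite fd; near: y; exact: (cvgr_dist_lt (@cvg_id _ _)).
Unshelve. all: by end_near. Qed.

Lemma dense_close (T : Type) (Y : metricType R) (i : T -> Y) y (e : R) :
  dense (range i) -> 0 < e -> exists m, mdist (i m) y < e.
Proof.
move=> di e0.
have [||z [/interior_subset zy [m _ mz]]] := di (ball y e)°.
- by exists y; exact: nbhsx_ballx.
- exact: open_interior.
- by exists m; move: zy; rewrite ballEmdist /= metric_sym mz.
Qed.

(** The points [i m] close to [y] give, through [j], a Cauchy filter in [Z]; its limit has the same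
    distances to the dense image. *)
Lemma completion_match (T : Type) (Y Z : metricType R) (i : T -> Y) (j : T -> Z) :
  (forall m n, mdist (i m) (i n) = mdist (j m) (j n)) ->
  dense (range i) -> complete_space Z ->
  forall y, exists z, forall m, mdist (i m) y = mdist (j m) z.
Proof.
move=> ij di cZ y.
pose F := filter_from [set e : R | 0 < e] (fun e => j @` [set m | mdist (i m) y < e]).
have FF : ProperFilter F.
  apply: filter_from_proper; last first.
    by move=> e /(dense_close y di)[m me]; exists (j m), m.
  apply: filter_from_filter; first by exists 1 => /=.
  move=> e e' /= e0 e0'; exists (Num.min e e'); first by rewrite /= lt_min e0.
  by move=> _ [m /= + <-]; rewrite lt_min => /andP[h h']; split; exists m.
have Fc : cauchy F.
  apply/cauchyP => e e0; have e20 : 0 < e / 2 by rewrite divr_gt0.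
  have [m hm] := dense_close y di e20.
  exists (j m), (e / 2) => // _ [n /= hn <-]; rewrite ballEmdist /= -ij.
  apply: le_lt_trans (metric_triangle _ y _) _.
  by rewrite [mdist y _]metric_sym [ltRHS]splitr ltrD.
have [z Fz] := cZ F FF Fc; exists z => m.
suff h e : 0 < e -> exists n, mdist (i n) y < e /\ mdist (j n) z < e.
  apply/eqP; rewrite eq_le; apply/andP; split; apply/ler_addgt0Pl => e e0;
  have [|n [hn hn']] := h (e / 2); first by rewrite divr_gt0.
    have := metric_triangle (i m) (i n) y; have := metric_triangle (j m) z (j n).
    by rewrite ij [mdist z _]metric_sym; lra.
  by rewrite divr_gt0.
  have := metric_triangle (j m) (j n) z; have := metric_triangle (i m) y (i n).
  by rewrite ij [mdist y _]metric_sym; lra.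
move=> e0; have [e' /= e'0 he'] := Fz _ (nbhsx_ballx z e e0).
have [|n] := @dense_close T Y i y (Num.min e e') di; first by rewrite lt_min e0.
rewrite lt_min => /andP[ne ne']; exists n; split=> //.
have : ball z e (j n) by apply: he'; exists n.
by rewrite ballEmdist /= metric_sym.
Qed.

(** Passing through [j m], [mdist z z'] is at most [mdist (i m) y + mdist (i m) y'], hence at most
    [mdist y y' + 2 * mdist (i m) y]. *)
Lemma match_dist_le (T : Type) (Y Z : metricType R) (i : T -> Y) (j : T -> Z) y y' z z' :
  dense (range i) ->
  (forall m, mdist (i m) y = mdist (j m) z) ->
  (forall m, mdist (i m) y' = mdist (j m) z') -> mdist z z' <= mdist y y'.
Proof.
move=> di yz yz'; apply/ler_addgt0Pl => e e0.
have [|m hm] := @dense_close T Y i y (e / 2) di; first by rewrite divr_gt0.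
have := metric_triangle z (j m) z'; have := metric_triangle (i m) y y'.
by rewrite [mdist z (j m)]metric_sym -yz -yz'; lra.
Qed.

Lemma completion_unique (M Y Z : metricType R) :
  is_completion M Y -> is_completion M Z -> homeomorphic Y Z.
Proof.
move=> [cY [i [id di]]] [cZ [j [jd dj]]].
have ij m n : mdist (i m) (i n) = mdist (j m) (j n) by rewrite id jd.
have ji m n : mdist (j m) (j n) = mdist (i m) (i n) by rewrite id jd.
have [f hf] := choice (completion_match ij di cZ).
have [g hg] := choice (completion_match ji dj cY).
have fd x y : mdist (f x) (f y) = mdist x y.
  by apply/eqP; rewrite eq_le (match_dist_le di (hf x) (hf y))
    (match_dist_le dj (fun m => esym (hf x m)) (fun m => esym (hf y m))).
have gd x y : mdist (g x) (g y) = mdist x y.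
  by apply/eqP; rewrite eq_le (match_dist_le dj (hg x) (hg y))
    (match_dist_le di (fun m => esym (hg x m)) (fun m => esym (hg y m))).
exists f, g; split.
(* Both [g (f y)] and [y] match [f y], so their distance is at most that of [f y] to itself. *)
- move=> y; apply/mdist_positivity/eqP; rewrite eq_le mdist_ge0 andbT -(mdistxx (f y)).
  by apply: (match_dist_le dj (fun m => esym _) (fun m => esym (hf y m))) => m; rewrite hg.
- move=> z; apply/mdist_positivity/eqP; rewrite eq_le mdist_ge0 andbT -(mdistxx (g z)).
  by apply: (match_dist_le di (fun m => esym _) (fun m => esym (hg z m))) => m; rewrite hf.
- exact: isometry_continuous.
- exact: isometry_continuous.
Qed.

Lemma compact_complete (Y : metricType R) : compact [set: Y] -> complete_space Y.
Proof.
move=> cY F FF Fc.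
have [x [_ Fx]] := cY F FF filterT.
exists x; apply/cvgrPdist_lt => e e0.
have e20 : 0 < e / 2 by rewrite divr_gt0.
(* A ball of radius [e / 4] has diameter at most [e / 2], which leaves [e / 2] for reaching the
   cluster point [x]. *)
move/cauchyP: Fc => /(_ (e / 2 / 2))[|y Fy]; first by rewrite divr_gt0.
have [z [yz xz]] := Fx _ _ Fy (nbhsx_ballx x _ e20).
apply: filterS Fy => t yt.
have : ball x e t.
  by have := ball_triangle xz (ball_splitr yz yt); rewrite -splitr.
by rewrite ballEmdist.
Qed.

End Completion.

(** * Finite Cantor-Bendixson derivatives *)

Definition derived_set (T : topologicalType) k : set T :=
  iter k (@limit_point T) setT.

Definition rank_set (T : topologicalType) k : set T :=
  derived_set k `\` derived_set k.+1.

(** For [n > 1] this topological property will hold of K_S exactly when n is in S. *)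
Definition has_rank_depth (n : nat) (T : topologicalType) : Prop :=
  exists x : T, (forall k, derived_set k x) /\
                (forall k, closure (rank_set k) x <-> (k < n)%N).

Lemma derived_set_homeo (S T : topologicalType) (f : S -> T) k x :
  injective f -> continuous f -> derived_set k x -> derived_set k (f x).
Proof.
move=> fi fc; elim: k x => // k ih x /= h U Ux.
have [y [yx ky Uy]] := h (f @^-1` U) (fc x U Ux).
by exists (f y); split=> //; [rewrite (inj_eq fi)|exact: ih].
Qed.

Lemma has_rank_depth_homeo n (S T : topologicalType) :
  homeomorphic S T -> has_rank_depth n S -> has_rank_depth n T.
Proof.
move=> [f [g [fK gK fc gc]]] [x [hx hn]].
have fi := can_inj fK; have gi := can_inj gK.
exists (f x); split=> [k|k]; first exact: derived_set_homeo.
rewrite -hn; split=> [h U Ux|h U Ux].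
  rewrite -(fK x) in Ux; have [y [[ky nky] Uy]] := h _ (gc _ _ Ux).
  exists (g y); split=> //; split; first exact: derived_set_homeo.
  by move=> /(derived_set_homeo fi fc); rewrite gK.
have [y [[ky nky] Uy]] := h _ (fc _ _ Ux).
exists (f y); split=> //; split; first exact: derived_set_homeo.
by move=> /(derived_set_homeo gi gc); rewrite fK.
Qed.

(** * Cardinality of the reals *)

Lemma cantor_uncountable : ~ countable [set: nat -> bool].
Proof.
move=> /countable_injP[f fi].
(* Cantor's diagonal, phrased over all preimages of [n] since [f] is only injective. *)
pose b n := `[< forall c, f c = n -> ~~ c n >].
suff : b (f b) <-> ~~ b (f b).
  by case: (b (f b)) => -[h1 h2]; [exact: (negP (h1 isT))|have := h2 isT].
split=> [/asboolP/(_ b erefl)//|nb]; apply/asboolP => c fc.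
by have -> : c = b by apply: fi; rewrite ?inE.
Qed.

Section Reals.
Variable R : realType.

(** Sequences are read as base 3 expansions with digits 0 and 1, which are unique. *)
Lemma cantor_card_le : [set: nat -> bool] #<= [set: R].
Proof.
pose s (b : nat -> bool) n : R := \sum_(i < n) (b i)%:R * 3^-1 ^+ i.
have sS b n : s b n.+1 = s b n + (b n)%:R * 3^-1 ^+ n by rewrite /s big_ord_recr.
have t0 n : 0 < (3^-1 : R) ^+ n by rewrite exprn_gt0// invr_gt0.
have tS n : (3^-1 : R) ^+ n.+1 = 3^-1 * 3^-1 ^+ n by rewrite exprS.
(* [3 / 2 * 3^-k] is the sum of the geometric tail from [k] on. *)
have sB b k n : s b (k + n)%N + 3 / 2 * 3^-1 ^+ (k + n) <= s b k + 3 / 2 * 3^-1 ^+ k.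
  elim: n => [|n]; first by rewrite addn0.
  apply: le_trans; rewrite addnS sS tS; have := t0 (k + n)%N.
  by case: (b _); rewrite /= ?mul1r ?mul0r; lra.
have sM b k n : s b k <= s b (k + n)%N.
  elim: n => [|n ih]; first by rewrite addn0.
  by rewrite addnS sS (le_trans ih)// lerDl mulr_ge0// ltW.
pose f b := sup (range (s b)).
have fub b k : ubound (range (s b)) (s b k + 3 / 2 * 3^-1 ^+ k).
  move=> _ [n _ <-]; have := sB b k n; have := sM b n k; have := t0 (k + n)%N.
  by rewrite (addnC n); lra.
have sup_s b : has_sup (range (s b)).
  by split; [exists (s b 0%N), 0%N|exists (s b 0%N + 3 / 2 * 3^-1 ^+ 0); exact: fub].
apply: (@card_le_inj _ _ f) => b c fbc.
apply/funext => n; have [m] := ubnP n; elim: m n => // m ih n nm.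
have e : s b n = s c n.
  by apply: eq_bigr => i _; rewrite ih//; have := ltn_ord i; lia.
(* At the first difference the digit 1 contributes 3^-n, twice the largest possible tail 3/2 *
   3^-(n+1). *)
have lt (x y : nat -> bool) : s x n = s y n -> x n -> ~~ y n -> f y < f x.
  move=> exy xn yn; apply: lt_le_trans (_ : s x n.+1 <= _); last first.
    by apply: ub_le_sup; [case: (sup_s x)|exists n.+1].
  apply: le_lt_trans (_ : _ <= s y n.+1 + 3 / 2 * 3^-1 ^+ n.+1) _.
    by apply: ge_sup; [case: (sup_s y)|exact: fub].
  by rewrite !sS xn (negbTE yn) tS exy; have := t0 n; rewrite /= ?mul1r ?mul0r; lra.
case bn: (b n); case cn : (c n) => //.
- by have := lt b c e; rewrite bn cn fbc ltxx => /(_ isT isT).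
- by have := lt c b (esym e); rewrite bn cn fbc ltxx => /(_ isT isT).
Qed.

(* Codes start at 2: every unmarked word is a limit of isolated points, so a
   point of depth at most 1 would not be distinguishable. *)
Definition cut_code (r : R) : set nat :=
  [set n | exists q : rat, n = (pickle q).+2 /\ ratr q < r].

Lemma cut_code_gt1 r n : cut_code r n -> (1 < n)%N.
Proof. by move=> [q [-> _]]. Qed.

(** A rational strictly between two reals is coded for the larger one only. *)
Lemma cut_code_inj : injective cut_code.
Proof.
have lt r s : cut_code r = cut_code s -> ~ r < s.
  move=> e /rat_in_itvoo[q]; rewrite in_itv /= => /andP[rq qs].
  have : cut_code s (pickle q).+2 by exists q.
  rewrite -e => -[p [[/(pcan_inj (@pickleK _)) <-]]].
  by rewrite ltNge (ltW rq).
move=> r s e; apply/eqP; rewrite eq_le !leNgt.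
by apply/andP; split; apply/negP; exact: lt.
Qed.

Lemma real_card_le : [set: R] #<= [set: nat -> bool].
Proof.
apply: (@card_le_inj _ _ (fun r n => `[< cut_code r n >])) => r s e.
apply: cut_code_inj; apply/funext => n; apply/propext.
by split=> /asboolP h; apply/asboolP; move: h; rewrite (congr1 (@^~ n) e).
Qed.

Lemma real_uncountable : ~ ([set: R] #= [set: nat]).
Proof.
rewrite card_eq_le => /andP[h _]; apply: cantor_uncountable.
exact: card_le_trans cantor_card_le h.
Qed.

Lemma carrier_card (S : set nat) : [set: carrier S] #= [set: R].
Proof.
rewrite card_eq_le; apply/andP; split.
  apply: card_le_trans cantor_card_le.
  (* Each letter takes two bits: even positions test for [Some true], odd ones for [None]. *)
  apply: (@card_le_inj _ _ (fun z n =>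
     \val z n./2 == if odd n then None else Some true)).
  move=> x y e; apply: val_inj; apply/funext => n.
  have := congr1 (@^~ n.*2) e; have := congr1 (@^~ n.*2.+1) e.
  rewrite /= odd_double /= doubleK uphalf_double.
  by case: (\val x n) (\val y n) => [[]|] [[]|].
apply: card_le_trans real_card_le _.
have K b : (fun n => Some (b n)) \in carrier S.
  by rewrite inE; exact: carrier_unmarked.
apply: (@card_le_inj _ _ (fun b => SigSub (K b) : carrier S)) => b c [e].
by apply/funext => n; have [] := congr1 (@^~ n) e.
Qed.

End Reals.

(** * The metric space of marked words *)

Section WordMetric.
Variable R : realType.

Definition word_dist (x y : word) : R :=
  if pselect (exists n, x n != y n) is left xy then (ex_minn xy).+1%:R^-1 else 0.

Lemma word_dist_ge0 x y : 0 <= word_dist x y.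
Proof. by rewrite /word_dist; case: pselect. Qed.

Lemma word_dist_lt x y n : (word_dist x y < n.+1%:R^-1) <-> agree n.+1 x y.
Proof.
rewrite /word_dist; case: pselect => [xy|xy]; last first.
  split=> [_ i _|_]; last by rewrite invr_gt0.
  by apply/eqP; apply: contra_notT xy => h; exists i.
case: ex_minnP => m xym mmin; rewrite ltf_pV2 ?posrE// ltr_nat ltnS.
split=> [nm i ni|h]; first by apply/eqP; apply: contraLR nm => /mmin; lia.
by rewrite ltnNge; apply/negP => mn; move: xym; rewrite h ?eqxx// ltnS.
Qed.

Lemma word_distxx x : word_dist x x = 0.
Proof.
by rewrite /word_dist; case: pselect => // xx; case: ex_minnP => n; rewrite eqxx.
Qed.

Lemma word_dist_eq0 x y : word_dist x y = 0 -> x = y.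
Proof.
move=> xy; apply/funext => n; have := (word_dist_lt x y n).1.
by rewrite xy invr_gt0 ltr0n => /(_ isT n (ltnSn n)).
Qed.

(** At the first index where [x] and [z] differ, [y] cannot agree with both. With [y] first in both
    distances, symmetry becomes a special case. *)
Lemma word_dist_max x y z :
  word_dist x z <= Num.max (word_dist y x) (word_dist y z).
Proof.
rewrite {1}/word_dist; case: pselect => [xz|_]; last by rewrite le_max word_dist_ge0.
case: ex_minnP => m xzm _; rewrite leNgt gt_max.
apply/negP => /andP[/word_dist_lt yx /word_dist_lt yz].
by move: xzm; rewrite -yx// yz// eqxx.
Qed.

Lemma word_dist_sym x y : word_dist x y = word_dist y x.
Proof.
apply/eqP; rewrite eq_le; apply/andP; split.
  by have := word_dist_max x y y; rewrite word_distxx max_l ?word_dist_ge0.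
by have := word_dist_max y x x; rewrite word_distxx max_l ?word_dist_ge0.
Qed.

Lemma word_dist_triangle y x z : word_dist x z <= word_dist x y + word_dist y z.
Proof.
apply: le_trans (word_dist_max x y z) _; rewrite [word_dist y x]word_dist_sym.
by rewrite ge_max lerDl lerDr !word_dist_ge0.
Qed.

(** Applied to the inclusion of the carrier it gives K_S, applied to an enumeration of the isolated
    points a metric on [X]; the enumeration is then isometric by computation. *)
Definition pullback_metric (X : Type) (e : X -> word) (ei : injective e) :
    metric_on R X :=
  MetricOn (fun x => word_distxx (e x))
    (fun x y xy => ei _ _ (word_dist_eq0 xy))
    (fun x y => word_dist_sym (e x) (e y))
    (fun y x z => word_dist_triangle (e y) (e x) (e z)).

Lemma nbhs_pullback (X : choiceType) (e : X -> word) (ei : injective e)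
    (x : metric_space (pullback_metric ei)) U :
  nbhs x U <-> exists N, forall y, agree N (e x) (e y) -> U y.
Proof.
split.
  rewrite -filter_from_mdist_nbhs => -[r /= r0 rU].
  have [n] := ltr_add_invr r0; rewrite add0r => nr; exists n.+1 => y xy.
  by apply: rU; apply: lt_trans nr; exact/word_dist_lt.
move=> [N h]; rewrite -filter_from_mdist_nbhs; exists N.+1%:R^-1 => /=.
  by rewrite invr_gt0.
by move=> y /word_dist_lt xy; apply: h => i iN; apply: xy; exact: leqW.
Qed.

Definition carrier_space (S : set nat) : metricType R :=
  metric_space (pullback_metric (@val_inj _ _ (carrier S))).


(** * Topology of the spaces K_S *)

Section Space.
Variable S : set nat.
Hypothesis S_gt1 : forall n, S n -> (1 < n)%N.

Let K := carrier_space S.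

Lemma nbhs_carrier (x : K) U :
  nbhs x U <-> exists N, forall y : K, agree N (\val x) (\val y) -> U y.
Proof. exact: nbhs_pullback. Qed.

Lemma carrier_valP (x : K) : carrier S (\val x).
Proof. exact: set_mem (valP x). Qed.

Lemma carrier_lift z : carrier S z -> exists x : K, \val x = z.
Proof. by move=> /mem_set Kz; exists (SigSub Kz : carrier S). Qed.

(** An ultrafilter selects one of three letters at each index and converges to the resulting word,
    which lies in the carrier by [carrier_closed]. *)
Lemma carrier_compact : compact [set: K].
Proof.
rewrite compact_ultra => F FU _.
have FP : ProperFilter F := ultra_proper.
have letter n : exists a, F [set x : K | \val x n = a].
  have [|h0] := in_ultra_setVsetC [set x : K | \val x n = None] FU.
    by exists None.
  have [|h1] := in_ultra_setVsetC [set x : K | \val x n = Some true] FU.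
    by exists (Some true).
  exists (Some false); apply: filterS (filterI h0 h1) => x [/=].
  by case: (\val x n) => [[]|].
have [z hz] := choice letter.
have Fz N : F [set x : K | agree N z (\val x)].
  elim: N => [|N ih]; first by apply: filterS filterT.
  apply: filterS (filterI ih (hz N)) => x [h /= xN] i; rewrite ltnS leq_eqVlt.
  by case/predU1P => [->|/h].
have Kz : carrier S z.
  apply: carrier_closed => N; have [x zx] := filter_ex (Fz N).
  by exists (\val x) => //; exact: carrier_valP.
have [x xz] := carrier_lift Kz; exists x; split=> // U /nbhs_carrier[N h].
by apply: filterS (Fz N) => y; rewrite -xz => /h.
Qed.

(** By induction: [rank_ge_shrink] removes the points of too small rank and [rank_ge_approach] keeps
    the others as limit points. *)
Lemma derived_set_carrier k (x : K) : derived_set k x <-> rank_ge S k (\val x).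
Proof.
elim: k x => [|k ih] x; first by split=> // _; exact: Or31.
split=> [h|rx U /nbhs_carrier[N hU]].
  apply: contrapT => nr.
  have [N hN] := rank_ge_shrink (carrier_valP x) nr.
  have [|y [/eqP yx /ih ry xy]] := h [set y : K | agree N (\val x) (\val y)].
    by apply/nbhs_carrier; exists N.
  by apply: yx; apply: val_inj; apply: hN => //; exact: carrier_valP.
have [z [Kz zx xz rz]] := rank_ge_approach N rx.
have [y yz] := carrier_lift Kz; rewrite -yz in zx xz rz.
exists y; split; [|exact/ih|exact: hU].
by apply/eqP => yx; apply: zx; rewrite yx.
Qed.

Lemma closure_rank_carrier k (x : K) : closure (rank_set k) x <->
  forall N, exists z, [/\ carrier S z, agree N (\val x) z,
                          rank_ge S k z & ~ rank_ge S k.+1 z].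
Proof.
split=> [h N|h U /nbhs_carrier[N hU]].
  have [|y [[ky nky] xy]] := h [set y : K | agree N (\val x) (\val y)].
    by apply/nbhs_carrier; exists N.
  exists (\val y); split=> //; [exact: carrier_valP|exact/derived_set_carrier|].
  by move=> /derived_set_carrier.
have [z [Kz xz rz nrz]] := h N.
have [y yz] := carrier_lift Kz; rewrite -yz in xz rz nrz.
exists y; split; last exact: hU.
by split; [exact/derived_set_carrier|move/derived_set_carrier].
Qed.

Lemma has_rank_depth_carrier n : (1 < n)%N -> has_rank_depth n K <-> S n.
Proof.
move=> n1; rewrite (rank_invariant S_gt1 n1).
split=> [[x [hx hn]]|[z [Kz hz hn]]].
  exists (\val x); split=> [|k|k]; [exact: carrier_valP|exact/derived_set_carrier|].
  by rewrite -hn closure_rank_carrier.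
have [x xz] := carrier_lift Kz; exists x; rewrite -xz in hz hn.
split=> k; first exact/derived_set_carrier.
by rewrite closure_rank_carrier.
Qed.

Lemma rank0_carrier_dense :
  dense [set x : K | ~ rank_ge S 1 (\val x)].
Proof.
move=> U [x Ux] oU; have /nbhs_carrier[N hU] := open_nbhs_nbhs (conj oU Ux).
have [z [Kz xz nz]] := rank_ge_dense S_gt1 N (carrier_valP x).
have [y yz] := carrier_lift Kz; rewrite -yz in xz nz.
by exists y; split=> //; exact: hU.
Qed.

Lemma rank0_isolated (x : K) : ~ rank_ge S 1 (\val x) ->
  exists N, forall y : K, agree N (\val x) (\val y) -> y = x.
Proof.
move=> nx; have [N hN] := rank_ge_shrink (carrier_valP x) nx.
exists N => y xy; apply: val_inj; apply: hN => //; first exact: carrier_valP.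
exact: Or31.
Qed.

Lemma rank0_enum (X : Type) : [set: X] #= [set: nat] ->
  exists e : X -> K, injective e /\ range e = [set x | ~ rank_ge S 1 (\val x)].
Proof.
move=> XN; have := card_eq_trans XN (card_esym (rank_eq0_card S_gt1)).
move=> /card_set_bijP[f [fI finj fsurj]].
have fK x : carrier S (f x) by have [] := fI x I.
have [e he] := choice (fun x => carrier_lift (fK x)).
exists e; split.
  by move=> x y exy; apply: finj; rewrite ?inE// -!he exy.
apply/seteqP; split=> [_ [x _ <-]|x nx] /=.
  by rewrite he; have [] := fI x I.
have [y _ yx] := fsurj (\val x) (conj (carrier_valP x) nx).
by exists y => //; apply: val_inj; rewrite he.
Qed.

End Space.

Lemma carrier_homeomorphic_inj (S T : set nat) :
  (forall n, S n -> (1 < n)%N) -> (forall n, T n -> (1 < n)%N) ->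
  homeomorphic (carrier_space S) (carrier_space T) -> S = T.
Proof.
move=> S1 T1 h; apply/seteqP; split=> n Sn.
  apply/(has_rank_depth_carrier T1 (S1 n Sn)); apply: has_rank_depth_homeo h _.
  exact/(has_rank_depth_carrier S1 (S1 n Sn)).
apply/(has_rank_depth_carrier S1 (T1 n Sn)).
apply: has_rank_depth_homeo (homeomorphic_sym h) _.
exact/(has_rank_depth_carrier T1 (T1 n Sn)).
Qed.

End WordMetric.

(** * Compactifications and incomplete metrics from K_S *)

Section Main.
Variable R : realType.

Lemma carrier_space_compactification (S : set nat) (X : discreteTopologicalType) :
  (forall n, S n -> (1 < n)%N) -> [set: X] #= [set: nat] ->
  is_compactification X (carrier_space R S).
Proof.
move=> S1 XN; split; [exact: carrier_compact|exact: metric_hausdorff|].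
have [e [ei eI]] := @rank0_enum R _ S1 _ XN.
exists (range e); split; first by rewrite eI; exact: rank0_carrier_dense.
have eA x : e x \in range e by rewrite inE; exists x.
have [|g gK] := @choice (range e) X (fun a x => e x = \val a).
  by move=> a; have [x _ xa] := set_mem (valP a); exists x.
pose f x : range e := SigSub (eA x).
exists f, g; split.
- by move=> x; apply: ei; rewrite gK.
- by move=> a; apply: val_inj; rewrite /= gK.
- move=> x U /nbhs_singleton Ux; apply: (_ : nbhs x (f @^-1` U)).
  by rewrite nbhs_principalE; exact/principal_filterP.
- move=> a U Ua.
  (* The points of [range e] are isolated in the whole space, so the subspace is discrete and [g] is
     continuous. *)
  have rk0 y : range e y -> ~ rank_ge S 1 (\val y) by rewrite eI.
  have [N hN] := rank0_isolated (rk0 _ (set_mem (valP a))).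
  have nN : nbhs (\val a) [set y | agree N (\val (\val a)) (\val y)].
    by apply/nbhs_carrier; exists N.
  have nA : nbhs a [set b : range e | agree N (\val (\val a)) (\val (\val b))].
    exact: (@initial_continuous _ _ (\val : range e -> _) a _ nN).
  apply: filterS nA => b /= /hN ba.
  by rewrite /= (val_inj ba); exact: nbhs_singleton.
Qed.

Lemma pullback_completion (S : set nat) (X : choiceType) (e : X -> carrier_space R S)
    (ei : injective (fun x => \val (e x))) :
  dense (range e) ->
  is_completion (metric_space (pullback_metric R ei)) (carrier_space R S).
Proof.
by move=> de; split; [exact/compact_complete/carrier_compact|exists e].
Qed.

End Main.

Theorem theorem7 (R : realType) :
  (forall X : discreteTopologicalType, [set: X] #= [set: nat] ->
     exists K : R -> topologicalType,
       (forall r, [/\ is_compactification X (K r), metrizable R (K r) &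
                      [set: K r] #= [set: R]]) /\
       (forall r s, r <> s -> ~ homeomorphic (K r) (K s)))
  /\
  (forall X : choiceType, [set: X] #= [set: nat] ->
     exists D : set (metric_on R X),
       [/\ D #= [set: R],
           (forall d, D d ->
              [/\ ~ complete_space (metric_space d),
                  discrete_space (metric_space d),
                  exists Y : metricType R, is_completion (metric_space d) Y &
                  forall Y : metricType R, is_completion (metric_space d) Y ->
                    compact [set: Y] /\ [set: Y] #= [set: R]]) &
           (forall d1 d2, D d1 -> D d2 -> d1 <> d2 ->
              forall Y1 Y2 : metricType R,
                is_completion (metric_space d1) Y1 ->
                is_completion (metric_space d2) Y2 ->
                ~ homeomorphic Y1 Y2)]).
Proof.
have cut1 r := @cut_code_gt1 R r.
split=> X XN.
  exists (fun r => carrier_space R (cut_code r)); split=> [r|r s rs].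
    split; [exact: carrier_space_compactification (cut1 r) XN| |exact: carrier_card].
    (* The topology comes from a [metric_on] by construction, and unification finds it. *)
    by eexists.
  by move=> /(carrier_homeomorphic_inj (cut1 r) (cut1 s))/cut_code_inj.
have /all_sig[e he] := fun r => cid (rank0_enum R (cut1 r) XN).
have ei r : injective (fun x => \val (e r x)).
  by move=> x y /val_inj; apply: (he r).1.
pose d r := pullback_metric R (ei r).
have dc r : is_completion (metric_space (d r)) (carrier_space R (cut_code r)).
  by apply: pullback_completion; rewrite (he r).2; exact: rank0_carrier_dense (cut1 r).
have dY r (Y : metricType R) : is_completion (metric_space (d r)) Y ->
    homeomorphic (carrier_space R (cut_code r)) Y.
  exact: completion_unique.
have dY_card r (Y : metricType R) : is_completion (metric_space (d r)) Y ->
    [set: Y] #= [set: R].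
  move=> /dY/homeomorphic_card/card_esym h.
  by apply: card_eq_trans h _; exact: carrier_card.
have dinj r s (Y Z : metricType R) : is_completion (metric_space (d r)) Y ->
    is_completion (metric_space (d s)) Z -> homeomorphic Y Z -> r = s.
  move=> /dY hY /dY /homeomorphic_sym hZ YZ.
  apply/cut_code_inj/(carrier_homeomorphic_inj (cut1 r) (cut1 s)).
  exact: homeomorphic_trans hY (homeomorphic_trans YZ hZ).
exists (range d); split.
(* Equal metrics share a completion, so their parameters agree. *)
- apply: inj_card_eq => r s _ _ rs; apply: (dinj _ _ _ _ (dc r)).
    by rewrite -rs; exact: dc.
  by exists idfun, idfun; split => //; move=> x.
- move=> _ [r _ <-]; split.
  (* A complete metric would make the countable [X] its own completion, of the cardinality of the
     reals. *)
  + move=> c; apply: (@real_uncountable R); apply: card_eq_trans _ XN.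
    apply: card_esym; apply: (dY_card r (metric_space (d r))); split=> //.
    exists idfun; split=> // U U0 _.
    have -> : range idfun = [set: metric_space (d r)].
      by apply/seteqP; split=> // x _; exists x.
    by rewrite setIT.
  + apply/funext => x; apply/seteqP.
    split=> [U /nbhs_singleton Ux|U /principal_filterP Ux].
      exact/principal_filterP.
    apply/nbhs_pullback.
    (* A prefix isolating [e r x] in K_S isolates [x] in the pulled back metric. *)
    have [|N hN] := @rank0_isolated R (cut_code r) (e r x).
      by have : range (e r) (e r x) by [exists x]; rewrite (he r).2.
    by exists N => y /hN/(he r).1 ->.
  + by exists (carrier_space R (cut_code r)).
  + move=> Y cY; split; last exact: dY_card cY.
    by apply: homeomorphic_compact (dY _ _ cY) _; exact: carrier_compact.
- move=> _ _ [r _ <-] [s _ <-] rs Y Z cY cZ YZ; apply: rs.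
  by rewrite (dinj _ _ _ _ cY cZ YZ).
Qed.
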